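(* Let $\gamma\subset\mathbb{C}$ be a smooth simple closed curve not passing through the origin, and let $L_\gamma$ be the associated twisted torus. Then $L_\gamma\subset\mathbb{C}^2$ is Hamiltonian stationary if and only if $\gamma$ is a circle centred at the origin.
   Context: Identify $\mathbb{C}^2\cong\mathbb{R}^4$ with its Euclidean metric and standard complex structure $J$ (multiplication by $i$). For a smooth regular simple closed curve $\gamma:\mathbb{R}/2\pi\mathbb{Z}\to\mathbb{C}\setminus\{0\}$, the twisted torus is $L_\gamma=\left\{\tfrac{1}{\sqrt2}\left(\gamma(\beta)e^{i\alpha},\gamma(\beta)e^{-i\alpha}\right):\alpha,\beta\in[0,2\pi)\right\}\subset\mathbb{C}^2$, an immersed Lagrangian torus parametrized by $F(\alpha,\beta)=\tfrac{1}{\sqrt2}(\gamma(\beta)e^{i\alpha},\gamma(\beta)e^{-i\alpha})$. Let $g$ be the induced metric, $H$ the mean curvature vector (trace with respect to $g$ of the second fundamental form, no normalizing factor), and $\mathrm{div}_g$ the divergence on the torus. $L_\gamma$ is called Hamiltonian stationary if it is a critical point of the area functional under all Hamiltonian variations, i.e. variations with variation field $J\nabla h$ for $h\in C^\infty(L_\gamma)$; by a result of Y.-G. Oh this is equivalent to $\mathrm{div}_g(JH)=0$. *)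

(* Defs.v *)
From Stdlib Require Import Reals.
From Coquelicot Require Import Coquelicot.
Open Scope R_scope.

(* ---------- Vectors in R^4 = C^2 ----------
   A vector is v : nat -> R, only components 0..3 matter:
   (v 0, v 1, v 2, v 3) = (Re z1, Im z1, Re z2, Im z2). *)
Definition V4 := nat -> R.

Definition dot (u v : V4) : R := u 0%nat * v 0%nat + u 1%nat * v 1%nat
  + u 2%nat * v 2%nat + u 3%nat * v 3%nat.
Definition vadd (u v : V4) : V4 := fun k => u k + v k.
Definition vsub (u v : V4) : V4 := fun k => u k - v k.
Definition vscal (c : R) (v : V4) : V4 := fun k => c * v k.

Definition Jmul (v : V4) : V4 := fun k =>
  match k with
  | 0%nat => - v 1%nat | 1%nat => v 0%nat
  | 2%nat => - v 3%nat | 3%nat => v 2%nat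
  | _ => 0 end.

Definition sum2 (f : nat -> R) : R := f 0%nat + f 1%nat.
Definition vsum2 (f : nat -> V4) : V4 := vadd (f 0%nat) (f 1%nat).

Definition pds (i : nat) (f : R -> R -> R) : R -> R -> R := fun a b =>
  match i with
  | 0%nat => Derive (fun s => f s b) a
  | _ => Derive (fun t => f a t) b end.

Definition pd (i : nat) (F : R -> R -> V4) : R -> R -> V4 :=
  fun a b k => pds i (fun a' b' => F a' b' k) a b.

Definition metric (F : R -> R -> V4) (i j : nat) (a b : R) : R :=
  dot (pd i F a b) (pd j F a b).

Definition detg (F : R -> R -> V4) (a b : R) : R :=
  metric F 0 0 a b * metric F 1 1 a b - metric F 0 1 a b * metric F 1 0 a b.

Definition ginv (F : R -> R -> V4) (i j : nat) (a b : R) : R :=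
  match i, j with
  | 0%nat, 0%nat => metric F 1 1 a b / detg F a b
  | 1%nat, 1%nat => metric F 0 0 a b / detg F a b
  | _, _ => - metric F 0 1 a b / detg F a b
  end.

Definition tanproj (F : R -> R -> V4) (a b : R) (v : V4) : V4 :=
  vsum2 (fun k => vsum2 (fun l =>
    vscal (ginv F k l a b * dot v (pd l F a b)) (pd k F a b))).
Definition normproj (F : R -> R -> V4) (a b : R) (v : V4) : V4 :=
  vsub v (tanproj F a b v).

Definition sff (F : R -> R -> V4) (i j : nat) (a b : R) : V4 :=
  normproj F a b (pd i (pd j F) a b).

Definition meancurv (F : R -> R -> V4) (a b : R) : V4 :=
  vsum2 (fun i => vsum2 (fun j => vscal (ginv F i j a b) (sff F i j a b))).

Definition tcomp (F : R -> R -> V4) (X : R -> R -> V4) (i : nat) (a b : R) : R :=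
  sum2 (fun j => ginv F i j a b * dot (X a b) (pd j F a b)).

Definition div_g (F : R -> R -> V4) (X : R -> R -> V4) (a b : R) : R :=
  / sqrt (detg F a b) *
  sum2 (fun i => pds i (fun a' b' => sqrt (detg F a' b') * tcomp F X i a' b') a b).

(* Hamiltonian stationary (via Oh's criterion): div_g (J H) = 0 everywhere *)
Definition hamiltonian_stationary (F : R -> R -> V4) : Prop :=
  forall a b : R, div_g F (fun a' b' => Jmul (meancurv F a' b')) a b = 0.

Definition smooth_fun (f : R -> R) : Prop := forall (n : nat) (t : R), ex_derive_n f n t.

Definition smooth_regular_simple_closed_curve_avoiding_0 (gamma : R -> C) : Prop :=
  smooth_fun (fun t => fst (gamma t)) /\ smooth_fun (fun t => snd (gamma t)) /\
  (forall t, gamma (t + 2 * PI) = gamma t) /\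
  (forall t, (Derive (fun s => fst (gamma s)) t, Derive (fun s => snd (gamma s)) t) <> (0, 0)) /\
  (forall s t, 0 <= s < 2 * PI -> 0 <= t < 2 * PI -> gamma s = gamma t -> s = t) /\
  (forall t, gamma t <> (0, 0)).

Definition twisted_torus (gamma : R -> C) : R -> R -> V4 := fun a b k =>
  let z1 := Cmult (gamma b) (cos a, sin a) in
  let z2 := Cmult (gamma b) (cos a, - sin a) in
  match k with
  | 0%nat => fst z1 / sqrt 2 | 1%nat => snd z1 / sqrt 2
  | 2%nat => fst z2 / sqrt 2 | 3%nat => snd z2 / sqrt 2
  | _ => 0 end.

Definition is_circle_centred_at_origin (gamma : R -> C) : Prop :=
  exists r : R, 0 < r /\ forall z : C, (exists t : R, gamma t = z) <-> Cmod z = r.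

(* Main.v *)
(* Write [r = |gamma|], [v = |gamma'|], [phi = arg gamma], [psi = arg gamma'] and
   [chi = psi - phi].  Then [div_g (J H) = 0] says that [(r / v) (psi' + phi')] is
   a constant [c], i.e. with respect to the time [tau] with [d tau = (v / r) dt],
     r' = r cos chi,   phi' = sin chi,   chi' = c - 2 sin chi,
   so that [r^2 (c - 2 sin chi)] is conserved.  If the periodic function [r] is
   not constant, comparing its extrema, where [sin chi = 1] or [-1], forces
   [|c| > 2]; by complex conjugation assume [c > 2].  Then [chi] is a bijection of
   the line and [phi] is an antiderivative of [sin chi / (c - 2 sin chi)] in the
   variable [chi], point-symmetric about [- pi / 2], where [r] is minimal.  This
   antiderivative returns to its value at [- pi / 2] at some [x] in [(0, pi / 2)],
   hence also at [- pi - x]; since [r] takes equal values there, gamma crosses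
   itself, at different angles [chi], and is not simple. *)
Require Import Defs.
From Stdlib Require Import Reals.
From Coquelicot Require Import Coquelicot.
From Stdlib Require Import Lra Psatz ZArith FunctionalExtensionality.
Open Scope R_scope.

(** * Calculus on the line *)

Lemma periodic_IZR (f : R -> R) (p : R) :
  (forall t, f (t + p) = f t) -> forall (n : Z) (t : R), f (t + IZR n * p) = f t.
Proof.
  intros Hp n. induction n as [|n IH|n IH] using Z.peano_ind; intros t.
  - f_equal. lra.
  - rewrite succ_IZR, <- (IH t), <- (Hp (t + IZR n * p)). f_equal. lra.
  - rewrite <- (IH t), <- (Hp (t + IZR (Z.pred n) * p)).
    unfold Z.pred. rewrite plus_IZR. f_equal. simpl. lra.
Qed.

Lemma fundamental_domain (p t : R) :
  0 < p -> exists (n : Z) (s : R), 0 <= s < p /\ t = s + IZR n * p.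
Proof.
  intros Hp. destruct (base_Int_part (t / p)) as [H1 H2].
  set (n := Int_part (t / p)) in *.
  assert (Et : t = t / p * p) by (field; lra).
  exists n, (t - IZR n * p). split; [|lra].
  rewrite Et at 1 2. nra.
Qed.

Lemma is_derive_zero_const (f : R -> R) :
  (forall t, is_derive f t 0) -> forall s t, f s = f t.
Proof.
  intros Hf s t.
  destruct (Rtotal_order s t) as [H|[H|H]].
  - exact (eq_is_derive f s t (fun u _ => Hf u) H).
  - now rewrite H.
  - symmetry. exact (eq_is_derive f t s (fun u _ => Hf u) H).
Qed.

Lemma is_derive_cont (f : R -> R) (t l : R) : is_derive f t l -> continuous f t.
Proof.
  intros H. apply (ex_derive_continuous (K := R_AbsRing) (V := R_NormedModule)).
  now exists l.
Qed.

Lemma exists_antiderivative (f : R -> R) (a v : R) :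
  (forall t, continuous f t) ->
  exists F : R -> R, F a = v /\ forall t, is_derive F t (f t).
Proof.
  intros Hf. exists (fun t => v + RInt f a t). split.
  - rewrite RInt_point. change (v + 0 = v). lra.
  - intros t.
    assert (H : is_derive (RInt f a) t (f t)).
    { apply is_derive_RInt with (a := a); [|apply Hf].
      apply filter_forall. intros b. apply RInt_correct.
      apply (ex_RInt_continuous (V := R_CompleteNormedModule)). intros; apply Hf. }
    evar_last.
    apply (is_derive_plus (K := R_AbsRing) (V := R_NormedModule)); [apply is_derive_const|exact H].
    change (0 + f t = f t). lra.
Qed.

Lemma mean_value (f df : R -> R) (a b : R) :
  (forall t, is_derive f t (df t)) -> a < b ->
  exists c, a < c < b /\ f b - f a = df c * (b - a).
Proof.
  intros H Hab. destruct (MVT_cor2 f df a b Hab) as [c [E Hc]].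
  - intros t _. apply is_derive_Reals, H.
  - now exists c.
Qed.

Lemma periodic_attains_min (f : R -> R) (p : R) :
  0 < p -> (forall t, continuous f t) -> (forall t, f (t + p) = f t) ->
  exists m, forall t, f m <= f t.
Proof.
  intros Hp Hc Hper.
  destruct (continuity_ab_min f 0 p) as [m [Hm _]]; [lra| |].
  - intros c _. apply continuity_pt_filterlim, Hc.
  - exists m. intros t. destruct (fundamental_domain p t Hp) as [n [s [Hs ->]]].
    rewrite periodic_IZR by assumption. apply Hm. lra.
Qed.

Lemma is_derive_at_min (f : R -> R) (m l : R) :
  is_derive f m l -> (forall t, f m <= f t) -> l = 0.
Proof.
  intros Hd Hm. apply is_derive_Reals in Hd.
  rewrite <- (derive_pt_eq_0 f m l (exist _ l Hd) Hd).
  apply deriv_minimum with (a := m - 1) (b := m + 1); [lra|lra|intros; apply Hm].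
Qed.

(** By periodicity [df] attains a minimum [k > 0], so [f] grows at least linearly in both directions
    and the intermediate value theorem applies. *)
Lemma surjective_of_periodic_pos_derive (f df : R -> R) (p : R) :
  0 < p -> (forall t, is_derive f t (df t)) -> (forall t, continuous df t) ->
  (forall t, df (t + p) = df t) -> (forall t, 0 < df t) ->
  forall y, exists t, f t = y.
Proof.
  intros Hp Hd Hc Hper Hpos y.
  destruct (periodic_attains_min df p Hp Hc Hper) as [m Hm].
  set (k := df m) in *. assert (Hk : 0 < k) by apply Hpos.
  (* Large enough that [k * d] exceeds the distance from [f 0] to [y], hence [f (- d) <= y <= f d];
     the summand 1 keeps [d] positive. *)
  set (d := Rabs (y - f 0) / k + 1).
  assert (Hd0 : 0 < d).
  { apply Rle_lt_0_plus_1, Rmult_le_pos; [apply Rabs_pos|].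
    apply Rlt_le, Rinv_0_lt_compat, Hk. }
  assert (Ed : k * d = Rabs (y - f 0) + k) by (unfold d; field; lra).
  destruct (mean_value f df 0 d Hd Hd0) as [c1 [_ E1]].
  destruct (mean_value f df (- d) 0 Hd) as [c2 [_ E2]]; [lra|].
  pose proof (Hm c1). pose proof (Hm c2).
  pose proof (Rle_abs (y - f 0)). pose proof (Rle_abs (- (y - f 0))) as Hn.
  rewrite Rabs_Ropp in Hn.
  assert (f (- d) <= y) by nra. assert (y <= f d) by nra.
  destruct (IVT_gen f (- d) d y) as [t [_ Ht]].
  - intros t. apply continuity_pt_filterlim, (is_derive_cont _ _ _ (Hd t)).
  - unfold Rmin, Rmax. destruct (Rle_dec (f (- d)) (f d)); lra.
  - now exists t.
Qed.

(** Write [(X + i Y) exp (- i chi) = A + i B]. Both [A] and [B] have derivative zero and equal 1 and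
    0 at [t0]. This stands in for uniqueness of the linear system and serves to lift both the
    tangent angle and the polar angle. *)
Lemma rotation_solution (X Y w chi : R -> R) (t0 : R) :
  (forall t, is_derive X t (- Y t * w t)) -> (forall t, is_derive Y t (X t * w t)) ->
  (forall t, is_derive chi t (w t)) ->
  X t0 = cos (chi t0) -> Y t0 = sin (chi t0) ->
  forall t, X t = cos (chi t) /\ Y t = sin (chi t).
Proof.
  intros HX HY Hchi EX EY t.
  assert (A : X t * cos (chi t) + Y t * sin (chi t) = 1).
  { transitivity (X t0 * cos (chi t0) + Y t0 * sin (chi t0)).
    - apply (is_derive_zero_const (fun t => X t * cos (chi t) + Y t * sin (chi t))).
      intros s. evar_last.
      + auto_derive; [repeat split; (eexists; now eauto)|reflexivity].
      + rewrite (is_derive_unique (fun x : R => X x) _ _ (HX s)),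
          (is_derive_unique (fun x : R => Y x) _ _ (HY s)),
          (is_derive_unique (fun x : R => chi x) _ _ (Hchi s)). ring.
    - rewrite EX, EY. pose proof (sin2_cos2 (chi t0)) as H. unfold Rsqr in H. lra. }
  assert (B : Y t * cos (chi t) - X t * sin (chi t) = 0).
  { transitivity (Y t0 * cos (chi t0) - X t0 * sin (chi t0)).
    - apply (is_derive_zero_const (fun t => Y t * cos (chi t) - X t * sin (chi t))).
      intros s. evar_last.
      + auto_derive; [repeat split; (eexists; now eauto)|reflexivity].
      + rewrite (is_derive_unique (fun x : R => X x) _ _ (HX s)),
          (is_derive_unique (fun x : R => Y x) _ _ (HY s)),
          (is_derive_unique (fun x : R => chi x) _ _ (Hchi s)). ring.
    - rewrite EX, EY. ring. }
  pose proof (sin2_cos2 (chi t)) as H. unfold Rsqr in H.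
  split.
  (* Multiplying back by [exp (i chi)]: [X] is the real part and [Y] the imaginary part of
     [(A + i B) exp (i chi)]. *)
  - transitivity ((X t * cos (chi t) + Y t * sin (chi t)) * cos (chi t)
      - (Y t * cos (chi t) - X t * sin (chi t)) * sin (chi t)); [|rewrite A, B; ring].
    rewrite <- (Rmult_1_r (X t)) at 1. rewrite <- H. ring.
  - transitivity ((X t * cos (chi t) + Y t * sin (chi t)) * sin (chi t)
      + (Y t * cos (chi t) - X t * sin (chi t)) * cos (chi t)); [|rewrite A, B; ring].
    rewrite <- (Rmult_1_r (Y t)) at 1. rewrite <- H. ring.
Qed.

Lemma unit_vector_angle (X Y : R) :
  X * X + Y * Y = 1 -> exists a, X = cos a /\ Y = sin a.
Proof.
  intros H.
  assert (HX : -1 <= X <= 1) by nra.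
  assert (E : sqrt (1 - X²) = Rabs Y).
  { rewrite <- sqrt_Rsqr_abs. f_equal. unfold Rsqr. lra. }
  destruct (Rle_dec 0 Y) as [HY|HY].
  - exists (acos X). rewrite cos_acos, sin_acos, E, Rabs_pos_eq; auto.
  - exists (- acos X). rewrite cos_neg, sin_neg, cos_acos, sin_acos, E, Rabs_left; lra.
Qed.

Lemma sumsq_pos (u v : R) : (u, v) <> (0, 0) -> 0 < u * u + v * v.
Proof.
  intros H. destruct (Req_dec u 0) as [->|Hu].
  - destruct (Req_dec v 0) as [->|Hv]; [now destruct H|]. pose proof (Rsqr_pos_lt v Hv). unfold Rsqr in *. lra.
  - pose proof (Rsqr_pos_lt u Hu). pose proof (Rle_0_sqr v). unfold Rsqr in *. lra.
Qed.

Lemma is_derive_periodic (f df : R -> R) (p : R) :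
  (forall t, is_derive f t (df t)) -> (forall t, f (t + p) = f t) ->
  forall t, df (t + p) = df t.
Proof.
  intros Hd Hp t. rewrite <- (is_derive_unique _ _ _ (Hd t)).
  symmetry. apply is_derive_unique.
  apply (is_derive_ext (fun s => f (s + p))); [exact Hp|].
  evar_last.
  - auto_derive; [repeat split; (eexists; now eauto)|reflexivity].
  - rewrite (is_derive_unique (fun s : R => f s) _ _ (Hd (t + p))). ring.
Qed.

(** * The autonomous system in polar coordinates *)

(** The reflection of [x] to [- PI - x] preserves [sin], so [D] has derivative
    [2 sin x / (c - 2 sin x)], and it vanishes at the fixed point [- PI / 2]. It is negative at 0,
    where only negative values of [sin] have contributed, and positive at [PI / 2], hence zero in
    between. *)
Lemma reflected_antiderivative_zero (c : R) (G : R -> R) :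
  2 < c -> (forall x, is_derive G x (sin x / (c - 2 * sin x))) ->
  exists x, 0 < x < PI / 2 /\ G x = G (- PI - x).
Proof.
  intros Hc HG. pose proof PI_RGT_0 as Hpi.
  set (D := fun x => G x - G (- PI - x)).
  assert (Hden : forall x, 0 < c - 2 * sin x) by (intros x; pose proof (SIN_bound x); lra).
  assert (HD : forall x, is_derive D x (2 * (sin x / (c - 2 * sin x)))).
  { intros x. unfold D. evar_last.
    - auto_derive; [repeat split; (eexists; now eauto)|reflexivity].
    - rewrite (is_derive_unique (fun x : R => G x) _ _ (HG x)).
      rewrite (is_derive_unique (fun x : R => G x) _ _ (HG (- PI + - x))).
      replace (sin (- PI + - x)) with (sin x).
      + pose proof (Hden x). field. lra.
      + replace (- PI + - x) with (- (x + PI)) by ring. rewrite sin_neg, neg_sin. ring. }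
  assert (D1 : D (- (PI / 2)) = 0).
  { unfold D. replace (- PI - - (PI / 2)) with (- (PI / 2)) by lra. ring. }
  assert (D2 : D 0 < 0).
  { destruct (mean_value D _ (- (PI / 2)) 0 HD) as [x [Hx E]]; [lra|].
    assert (sin x < 0) by (apply sin_lt_0_var; lra).
    assert (0 < - sin x / (c - 2 * sin x)) by (apply Rdiv_lt_0_compat; [lra|apply Hden]).
    replace (- sin x / (c - 2 * sin x)) with (- (sin x / (c - 2 * sin x))) in *
      by (pose proof (Hden x); field; lra).
    nra. }
  assert (D3 : 0 < D (PI / 2)).
  (* Contributions of [x] and [- x] are paired: the denominator is smaller where [sin] is positive,
     so the sum is positive. Since [D (- PI / 2) = 0], the increment over [[0, PI / 2]] is
     [D (PI / 2)] itself. *)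
  { destruct (mean_value (fun x => D x - D (- x))
      (fun x => 2 * (sin x / (c - 2 * sin x)) + 2 * (sin (- x) / (c - 2 * sin (- x))))
      0 (PI / 2)) as [x [Hx E]]; [|lra|].
    - intros x. evar_last.
      + auto_derive; [repeat split; (eexists; now eauto)|reflexivity].
      + rewrite (is_derive_unique (fun x : R => D x) _ _ (HD x)).
        rewrite (is_derive_unique (fun x : R => D x) _ _ (HD (- x))). ring.
    - assert (Hs : 0 < sin x) by (apply sin_gt_0; lra).
      pose proof (Hden x) as P1. pose proof (Hden (- x)) as P2. rewrite sin_neg in *.
      rewrite D1, Ropp_0 in E.
      assert (0 < 2 * (sin x / (c - 2 * sin x)) + 2 * (- sin x / (c - 2 * - sin x))).
      { replace (2 * (sin x / (c - 2 * sin x)) + 2 * (- sin x / (c - 2 * - sin x)))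
          with (8 * (sin x * sin x) / ((c - 2 * sin x) * (c - 2 * - sin x))) by (field; lra).
        apply Rdiv_lt_0_compat; nra. }
      nra. }
  destruct (IVT_gen D 0 (PI / 2) 0) as [x [Hx Dx]].
  - intros t. apply continuity_pt_filterlim, (is_derive_cont _ _ _ (HD t)).
  - unfold Rmin, Rmax. destruct (Rle_dec (D 0) (D (PI / 2))); lra.
  - rewrite Rmin_left, Rmax_right in Hx by lra.
    exists x. split; [|unfold D in Dx; lra].
    split.
    + destruct (Req_dec x 0) as [E|E]; [rewrite E in Dx|]; lra.
    + destruct (Req_dec x (PI / 2)) as [E|E]; [rewrite E in Dx|]; lra.
Qed.

(* The curve is [r (X + i Y)], [rho] is [|gamma'| / |gamma|], and [C + i S] is
   the unit tangent in the moving frame [(X + i Y, i (X + i Y))]; the derivatives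
   of [S] and [C] express that the curve is Hamiltonian stationary with constant [c]. *)
Record polar_system (rho S C r X Y : R -> R) (c : R) : Prop := {
  ps_rho : forall t, 0 < rho t;
  ps_rho_cont : forall t, continuous rho t;
  ps_rho_per : forall t, rho (t + 2 * PI) = rho t;
  ps_r : forall t, 0 < r t;
  ps_r_per : forall t, r (t + 2 * PI) = r t;
  ps_S_per : forall t, S (t + 2 * PI) = S t;
  ps_SC : forall t, C t * C t + S t * S t = 1;
  ps_XY : forall t, X t * X t + Y t * Y t = 1;
  ps_dr : forall t, is_derive r t (r t * rho t * C t);
  ps_dC : forall t, is_derive C t (- S t * (rho t * (c - 2 * S t)));
  ps_dS : forall t, is_derive S t (C t * (rho t * (c - 2 * S t)));
  ps_dX : forall t, is_derive X t (- Y t * (rho t * S t));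
  ps_dY : forall t, is_derive Y t (X t * (rho t * S t))
}.

(** Complex conjugation of the curve; it reduces [c < -2] to [c > 2]. *)
Lemma polar_system_conj (rho S C r X Y : R -> R) (c : R) :
  polar_system rho S C r X Y c ->
  polar_system rho (fun t => - S t) C r X (fun t => - Y t) (- c).
Proof.
  intros [H1 H2 H3 H4 H5 H6 H7 H8 Hr HC HS HX HY].
  assert (neg : forall f t l m, is_derive f t l -> - l = m -> is_derive (fun s => - f s) t m).
  { intros f t l m H <-. apply (is_derive_opp (K := R_AbsRing) (V := R_NormedModule)), H. }
  constructor; auto; intros t.
  - now rewrite H6.
  - rewrite <- (H7 t). ring.
  - rewrite <- (H8 t). ring.
  - evar_last; [apply HC|]. ring.
  - eapply neg; [apply HS|]. ring.
  - evar_last; [apply HX|]. ring.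
  - eapply neg; [apply HY|]. ring.
Qed.

(** The logarithmic rates cancel: [r^2] grows at rate [2 rho C], while the derivative of [c - 2 S]
    is [- 2 rho C] times itself. *)
Lemma polar_system_energy (rho S C r X Y : R -> R) (c : R) :
  polar_system rho S C r X Y c ->
  forall s t, r s * r s * (c - 2 * S s) = r t * r t * (c - 2 * S t).
Proof.
  intros P. apply (is_derive_zero_const (fun t => r t * r t * (c - 2 * S t))).
  intros t. pose proof (ps_dr _ _ _ _ _ _ _ P t) as Hr. pose proof (ps_dS _ _ _ _ _ _ _ P t) as HS.
  evar_last.
  - auto_derive; [repeat split; (eexists; now eauto)|reflexivity].
  - rewrite (is_derive_unique (fun x : R => r x) _ _ Hr).
    rewrite (is_derive_unique (fun x : R => S x) _ _ HS). ring.
Qed.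

(** At the extrema of [r] the tangent is perpendicular to the position, so [S] is 1 or -1 there; the
    conserved quantity then compares the two extrema. *)
Lemma polar_system_cases (rho S C r X Y : R -> R) (c : R) :
  polar_system rho S C r X Y c ->
  (forall s t, r s = r t) \/ (2 < c /\ exists t0, S t0 = -1)
  \/ (c < -2 /\ exists t0, S t0 = 1).
Proof.
  intros P. pose proof (polar_system_energy _ _ _ _ _ _ _ P) as En.
  assert (H2pi : 0 < 2 * PI) by (pose proof PI_RGT_0; lra).
  pose proof (ps_r _ _ _ _ _ _ _ P) as Hr. pose proof (ps_dr _ _ _ _ _ _ _ P) as Hdr.
  pose proof (ps_rho _ _ _ _ _ _ _ P) as Hrho. pose proof (ps_SC _ _ _ _ _ _ _ P) as HSC.
  destruct (periodic_attains_min r (2 * PI) H2pi) as [m Hm].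
  { intros t. exact (is_derive_cont _ _ _ (Hdr t)). }
  { apply P. }
  assert (Hdo : forall t, is_derive (fun s => - r s) t (- (r t * rho t * C t))).
  { intros t. apply (is_derive_opp (K := R_AbsRing) (V := R_NormedModule)), Hdr. }
  (* The maximum of [r] is obtained as the minimum of [- r]. *)
  destruct (periodic_attains_min (fun t => - r t) (2 * PI) H2pi) as [M HM].
  { intros t. exact (is_derive_cont _ _ _ (Hdo t)). }
  { intros t. now rewrite (ps_r_per _ _ _ _ _ _ _ P). }
  assert (C0 : forall t, r t * rho t * C t = 0 -> S t = 1 \/ S t = -1).
  { intros t H. assert (E : C t = 0).
    { apply Rmult_integral in H. destruct H as [H|H]; [|exact H].
      pose proof (Rmult_lt_0_compat _ _ (Hr t) (Hrho t)). lra. }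
    specialize (HSC t). rewrite E in HSC.
    assert (F : (S t - 1) * (S t + 1) = 0) by lra.
    apply Rmult_integral in F. destruct F; [left|right]; lra. }
  pose proof (C0 m (is_derive_at_min _ _ _ (Hdr m) Hm)) as Cm.
  assert (CM : S M = 1 \/ S M = -1).
  { apply C0. pose proof (is_derive_at_min _ _ _ (Hdo M) HM). lra. }
  destruct (Req_dec (r m) (r M)) as [E|NE].
  { left. assert (F : forall t, r t = r m).
    { intros t. pose proof (Hm t). pose proof (HM t). simpl in *. lra. }
    intros s t. now rewrite !F. }
  assert (Hlt : r m * r m < r M * r M).
  { pose proof (HM m). simpl in *. pose proof (Hr m). nra. }
  pose proof (Rmult_lt_0_compat _ _ (Hr m) (Hr m)) as Pm.
  pose proof (En m M) as EmM.
  (* Equal values of [S] at extrema with different radii force the conserved quantity to be zero.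
     Then [c - 2 S] vanishes everywhere, so [S] keeps its extremal value, [C] is zero and [r] has
     derivative zero. *)
  assert (Heq : S m = S M -> forall s t, r s = r t).
  { intros ES. rewrite ES in EmM.
    assert (Z : c - 2 * S M = 0) by nra.
    apply is_derive_zero_const. intros t.
    assert (Zt : c - 2 * S t = 0).
    { specialize (En t M). rewrite Z, Rmult_0_r in En.
      apply Rmult_integral in En. pose proof (Rmult_lt_0_compat _ _ (Hr t) (Hr t)). lra. }
    assert (Ct : C t = 0).
    { specialize (HSC t). replace (S t) with (S M) in HSC by lra.
      assert (C t * C t = 0) as K by (destruct CM as [K|K]; rewrite K in HSC; lra).
      apply Rmult_integral in K. lra. }
    evar_last; [apply Hdr|]. rewrite Ct. ring. }
  (* If [S m = -1] and [S M = 1], conservation reads [r_m^2 (c + 2) = r_M^2 (c - 2)], and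
     [r_m < r_M] gives [c > 2]; the opposite signs give [c < -2]. *)
  destruct Cm as [Em|Em], CM as [EM|EM].
  - left. apply Heq. congruence.
  - right. right. rewrite Em, EM in EmM. split; [nra|eauto].
  - right. left. rewrite Em, EM in EmM. split; [nra|eauto].
  - left. apply Heq. congruence.
Qed.

(** For [c > 2] the angle [chi] is strictly increasing and takes every real value, and the polar
    angle is a function [G] of [chi]. Reflecting [chi] to [- PI - chi] keeps [sin chi], hence [r],
    and negates [cos chi]; at the zero found above the polar angle agrees too. *)
Lemma polar_system_double_point (rho S C r X Y : R -> R) (c t0 : R) :
  polar_system rho S C r X Y c -> 2 < c -> S t0 = -1 ->
  exists t1 t2, r t1 = r t2 /\ X t1 = X t2 /\ Y t1 = Y t2 /\ C t1 <> C t2.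
Proof.
  intros P Hc HS0. pose proof (polar_system_energy _ _ _ _ _ _ _ P) as En.
  destruct P as [Hrho Hrhoc Hrhop Hr Hrp HSp HSC HXY Hdr HdC HdS HdX HdY].
  assert (HSb : forall t, -1 <= S t <= 1) by (intros t; specialize (HSC t); nra).
  assert (HScont : forall t, continuous S t) by (intros t; exact (is_derive_cont _ _ _ (HdS t))).
  assert (Hw : forall t, continuous (fun t => rho t * (c - 2 * S t)) t).
  { intros t. apply (continuous_mult (K := R_AbsRing)); [apply Hrhoc|].
    apply (continuous_minus (K := R_AbsRing) (V := R_NormedModule)); [apply continuous_const|].
    apply (continuous_mult (K := R_AbsRing)); [apply continuous_const|apply HScont]. }
  (* The initial value [- PI / 2] matches [S t0 = -1], which also forces [C t0 = 0]. *)
  destruct (exists_antiderivative _ t0 (- (PI / 2)) Hw) as [chi [chi0 Hchi]].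
  destruct (exists_antiderivative (fun t => rho t * S t) t0 0) as [phi0 [_ Hphi0]].
  { intros t. apply (continuous_mult (K := R_AbsRing)); [apply Hrhoc|apply HScont]. }
  destruct (unit_vector_angle _ _ (HXY t0)) as [a [Xa Ya]].
  assert (HCS : forall t, C t = cos (chi t) /\ S t = sin (chi t)).
  { apply (rotation_solution C S _ chi t0 HdC HdS Hchi); rewrite chi0.
    - rewrite cos_neg, cos_PI2. specialize (HSC t0). rewrite HS0 in HSC. nra.
    - rewrite sin_neg, sin_PI2. exact HS0. }
  assert (Hden : forall x, 0 < c - 2 * sin x) by (intros x; pose proof (SIN_bound x); lra).
  (* The integrand is the quotient of the polar angular velocity [rho S] by [chi' = rho (c - 2 S)];
     the initial value [a] is the polar angle at [t0]. *)
  destruct (exists_antiderivative (fun x => sin x / (c - 2 * sin x)) (- (PI / 2)) a) as [G [G0 HG]].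
  { intros x. apply (ex_derive_continuous (K := R_AbsRing) (V := R_NormedModule)).
    auto_derive. pose proof (Hden x). lra. }
  assert (HGchi : forall t, is_derive (fun t => G (chi t)) t (rho t * S t)).
  { intros t. evar_last.
    - apply (is_derive_comp (K := R_AbsRing) (V := R_NormedModule)); [apply HG|apply Hchi].
    - destruct (HCS t) as [_ ->]. pose proof (Hden (chi t)).
      unfold scal; simpl; unfold mult; simpl. field. lra. }
  assert (HXG : forall t, X t = cos (G (chi t)) /\ Y t = sin (G (chi t))).
  { apply (rotation_solution X Y _ _ t0 HdX HdY HGchi); rewrite chi0, G0; assumption. }
  destruct (reflected_antiderivative_zero c G Hc HG) as [x [Hx Gx]].
  assert (Hsurj : forall y, exists t, chi t = y).
  { apply (surjective_of_periodic_pos_derive chi _ (2 * PI)) with (2 := Hchi); auto.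
    - pose proof PI_RGT_0. lra.
    - intros t. now rewrite Hrhop, HSp.
    - intros t. apply Rmult_lt_0_compat; [apply Hrho|]. specialize (HSb t). lra. }
  destruct (Hsurj x) as [t1 E1]. destruct (Hsurj (- PI - x)) as [t2 E2].
  assert (Es : sin (- PI - x) = sin x).
  { replace (- PI - x) with (- (x + PI)) by ring. rewrite sin_neg, neg_sin. ring. }
  assert (Ec : cos (- PI - x) = - cos x).
  { replace (- PI - x) with (- (x + PI)) by ring. rewrite cos_neg, neg_cos. ring. }
  exists t1, t2. repeat split.
  (* Equal sines leave the same nonzero factor [c - 2 sin x] on both sides of the conservation law,
     so the positive radii agree. *)
  - specialize (En t1 t2). destruct (HCS t1) as [_ S1]. destruct (HCS t2) as [_ S2].
    rewrite S1, S2, E1, E2, Es in En. apply Rmult_eq_reg_r in En; [|pose proof (Hden x); lra].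
    pose proof (Hr t1). pose proof (Hr t2). nra.
  - destruct (HXG t1) as [-> _]. destruct (HXG t2) as [-> _]. now rewrite E1, E2, Gx.
  - destruct (HXG t1) as [_ ->]. destruct (HXG t2) as [_ ->]. now rewrite E1, E2, Gx.
  - destruct (HCS t1) as [-> _]. destruct (HCS t2) as [-> _]. rewrite E1, E2, Ec.
    assert (0 < cos x) by (apply cos_gt_0; lra). lra.
Qed.

(** Simplicity enters as equality of [C] at coinciding positions rather than equality of parameters,
    since on the whole line parameters are determined only up to the period. *)
Lemma polar_system_simple_radius_const (rho S C r X Y : R -> R) (c : R) :
  polar_system rho S C r X Y c ->
  (forall t1 t2, r t1 = r t2 -> X t1 = X t2 -> Y t1 = Y t2 -> C t1 = C t2) ->
  forall s t, r s = r t.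
Proof.
  intros P Hinj.
  destruct (polar_system_cases _ _ _ _ _ _ _ P) as [H|[[Hc [t0 H0]]|[Hc [t0 H0]]]]; [exact H| |].
  - destruct (polar_system_double_point _ _ _ _ _ _ _ _ P Hc H0) as (t1 & t2 & E1 & E2 & E3 & N).
    destruct N. auto.
  - apply polar_system_conj in P.
    destruct (polar_system_double_point _ _ _ _ _ _ _ t0 P) as (t1 & t2 & E1 & E2 & E3 & N);
      [lra|lra|].
    destruct N. apply Hinj; auto; lra.
Qed.

(** * Plane curves *)

Lemma nonvanishing_sign (f : R -> R) :
  (forall t, continuous f t) -> (forall t, f t <> 0) ->
  (forall t, 0 < f t) \/ (forall t, f t < 0).
Proof.
  intros Hc Hn.
  assert (Hsign : forall s t, 0 < f s -> f t < 0 -> False).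
  { intros s t Hs Ht. destruct (IVT_gen f s t 0) as [u [_ Hu]].
    - intros u. apply continuity_pt_filterlim, Hc.
    - unfold Rmin, Rmax. destruct (Rle_dec (f s) (f t)); lra.
    - exact (Hn u Hu). }
  destruct (Rdichotomy _ _ (Hn 0)) as [H0|H0].
  - right. intros t. destruct (Rdichotomy _ _ (Hn t)) as [H|H]; [exact H|].
    destruct (Hsign t 0); assumption.
  - left. intros t. destruct (Rdichotomy _ _ (Hn t)) as [H|H]; [|exact H].
    destruct (Hsign 0 t); assumption.
Qed.

Lemma constant_modulus_orthogonal (x y x1 y1 : R -> R) (m : R) :
  (forall t, is_derive x t (x1 t)) -> (forall t, is_derive y t (y1 t)) ->
  (forall t, x t * x t + y t * y t = m) ->
  forall t, x t * x1 t + y t * y1 t = 0.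
Proof.
  intros Hx Hy Hxy t.
  assert (E : is_derive (fun t => x t * x t + y t * y t) t (2 * (x t * x1 t + y t * y1 t))).
  { evar_last.
    - auto_derive; [repeat split; (eexists; now eauto)|reflexivity].
    - rewrite (is_derive_unique (fun s : R => x s) _ _ (Hx t)),
        (is_derive_unique (fun s : R => y s) _ _ (Hy t)). ring. }
  assert (E0 : is_derive (fun t => x t * x t + y t * y t) t 0).
  { apply (is_derive_ext (fun _ => m)); [intros; now rewrite Hxy|].
    apply (is_derive_const (K := R_AbsRing) (V := R_NormedModule)). }
  apply is_derive_unique in E. apply is_derive_unique in E0. lra.
Qed.

(** The angular velocity [w] is continuous, periodic and never zero, so it has a constant sign and
    the lifted polar angle takes every real value. *)
Lemma constant_modulus_curve_covers_circle (x y x1 y1 : R -> R) (p r : R) :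
  (forall t, is_derive x t (x1 t)) -> (forall t, is_derive y t (y1 t)) ->
  (forall t, continuous x1 t) -> (forall t, continuous y1 t) ->
  0 < p ->
  (forall t, x (t + p) = x t) -> (forall t, y (t + p) = y t) ->
  (forall t, x1 (t + p) = x1 t) -> (forall t, y1 (t + p) = y1 t) ->
  (forall t, 0 < x1 t * x1 t + y1 t * y1 t) ->
  0 < r -> (forall t, x t * x t + y t * y t = r * r) ->
  forall u v, u * u + v * v = r * r -> exists t, x t = u /\ y t = v.
Proof.
  intros Hx Hy Hx1 Hy1 Hp Px Py Px1 Py1 Hv Hr Hxy u v Huv.
  pose proof (constant_modulus_orthogonal x y x1 y1 (r * r) Hx Hy Hxy) as HD.
  set (w := fun t => (x t * y1 t - y t * x1 t) / (r * r)).
  assert (Hw : forall t, continuous w t).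
  { intros t. unfold w, Rdiv. apply (continuous_mult (K := R_AbsRing)); [|apply continuous_const].
    apply (continuous_minus (K := R_AbsRing) (V := R_NormedModule));
      apply (continuous_mult (K := R_AbsRing)); auto.
    - exact (is_derive_cont _ _ _ (Hx t)).
    - exact (is_derive_cont _ _ _ (Hy t)). }
  assert (Hrr : 0 < r * r) by nra.
  assert (Hw0 : forall t, w t <> 0).
  { intros t E. assert (E' : x t * y1 t - y t * x1 t = 0).
    { replace (x t * y1 t - y t * x1 t) with (w t * (r * r)) by (unfold w; field; lra).
      rewrite E. ring. }
    (* Lagrange's identity: position and velocity are orthogonal, so a vanishing cross product would
       contradict regularity. *)
    assert (K : (x t * x t + y t * y t) * (x1 t * x1 t + y1 t * y1 t)
      = (x t * x1 t + y t * y1 t) ^ 2 + (x t * y1 t - y t * x1 t) ^ 2) by ring.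
    rewrite HD, E', Hxy in K. specialize (Hv t).
    pose proof (Rmult_lt_0_compat _ _ Hrr Hv). lra. }
  destruct (unit_vector_angle (x 0 / r) (y 0 / r)) as [a [Xa Ya]].
  { transitivity ((x 0 * x 0 + y 0 * y 0) / (r * r)); [field; lra|]. rewrite Hxy. field. lra. }
  destruct (unit_vector_angle (u / r) (v / r)) as [b [Ub Vb]].
  { transitivity ((u * u + v * v) / (r * r)); [field; lra|]. rewrite Huv. field. lra. }
  destruct (exists_antiderivative w 0 a Hw) as [phi [phi0 Hphi]].
  assert (HXY : forall t, x t / r = cos (phi t) /\ y t / r = sin (phi t)).
  { apply (rotation_solution (fun t => x t / r) (fun t => y t / r) w phi 0).
    - intros t. evar_last.
      + auto_derive; [repeat split; (eexists; now eauto)|reflexivity].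
      + rewrite (is_derive_unique (fun x0 : R => x x0) _ _ (Hx t)). unfold w.
        (* Orthogonality makes the velocity [w] times the position rotated by a right angle. The two
           sides differ by [x] times the vanishing inner product. *)
        assert (K : x1 t * (r * r) = - y t * (x t * y1 t - y t * x1 t)).
        { rewrite <- (Hxy t). pose proof (f_equal (Rmult (x t)) (HD t)). nra. }
        transitivity (x1 t * (r * r) / (r * r * r)); [field; lra|]. rewrite K. field. lra.
    - intros t. evar_last.
      + auto_derive; [repeat split; (eexists; now eauto)|reflexivity].
      + rewrite (is_derive_unique (fun x0 : R => y x0) _ _ (Hy t)). unfold w.
        assert (K : y1 t * (r * r) = x t * (x t * y1 t - y t * x1 t)).
        { rewrite <- (Hxy t). pose proof (f_equal (Rmult (y t)) (HD t)). nra. }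
        transitivity (y1 t * (r * r) / (r * r * r)); [field; lra|]. rewrite K. field. lra.
    - exact Hphi.
    - now rewrite phi0.
    - now rewrite phi0. }
  assert (Hper : forall t, w (t + p) = w t).
  { intros t. unfold w. now rewrite Px, Py, Px1, Py1. }
  assert (Hs : exists t, phi t = b).
  { destruct (nonvanishing_sign w Hw Hw0) as [S|S].
    - exact (surjective_of_periodic_pos_derive phi w p Hp Hphi Hw Hper S b).
    - destruct (surjective_of_periodic_pos_derive (fun t => - phi t) (fun t => - w t) p Hp) with (y := - b)
        as [t Ht].
      + intros t. apply (is_derive_opp (K := R_AbsRing) (V := R_NormedModule)), Hphi.
      + intros t. apply (continuous_opp (K := R_AbsRing) (V := R_NormedModule)), Hw.
      + intros t. now rewrite Hper.
      + intros t. specialize (S t). lra.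
      + exists t. lra. }
  destruct Hs as [t Ht]. exists t. destruct (HXY t) as [E1 E2].
  rewrite Ht, <- Ub in E1. rewrite Ht, <- Vb in E2.
  split; apply (Rmult_eq_reg_r (/ r)); auto; apply Rinv_neq_0_compat; lra.
Qed.

Lemma is_derive_modulus (x y : R -> R) (t dx dy : R) :
  is_derive x t dx -> is_derive y t dy -> 0 < x t * x t + y t * y t ->
  is_derive (fun t => sqrt (x t * x t + y t * y t)) t
    ((x t * dx + y t * dy) / sqrt (x t * x t + y t * y t)).
Proof.
  intros Hx Hy Hpos. evar_last.
  - auto_derive; [repeat split; try (eexists; now eauto); exact Hpos|reflexivity].
  - rewrite (is_derive_unique (fun x0 : R => x x0) _ _ Hx),
      (is_derive_unique (fun x0 : R => y x0) _ _ Hy).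
    pose proof (sqrt_lt_R0 _ Hpos). field. lra.
Qed.

(** The last hypothesis is [(r / v) (phi' + psi') = c]. As [phi' = (v / r) S], the angle
    [chi = psi - phi] satisfies [chi' = (v / r) (c - 2 S)]. The proof verifies this on [C] and [S]
    directly, without choosing angles. *)
Lemma polar_system_of_curve (x y x1 y1 x2 y2 r v : R -> R) (c : R) :
  (forall t, is_derive x t (x1 t)) -> (forall t, is_derive y t (y1 t)) ->
  (forall t, is_derive x1 t (x2 t)) -> (forall t, is_derive y1 t (y2 t)) ->
  (forall t, 0 < r t) -> (forall t, r t * r t = x t * x t + y t * y t) ->
  (forall t, 0 < v t) -> (forall t, v t * v t = x1 t * x1 t + y1 t * y1 t) ->
  (forall t, is_derive r t ((x t * x1 t + y t * y1 t) / r t)) ->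
  (forall t, is_derive v t ((x1 t * x2 t + y1 t * y2 t) / v t)) ->
  (forall t, x (t + 2 * PI) = x t) -> (forall t, y (t + 2 * PI) = y t) ->
  (forall t, x1 (t + 2 * PI) = x1 t) -> (forall t, y1 (t + 2 * PI) = y1 t) ->
  (forall t, r (t + 2 * PI) = r t) -> (forall t, v (t + 2 * PI) = v t) ->
  (forall t, r t / v t * ((x t * y1 t - y t * x1 t) / (r t * r t)
     + (x1 t * y2 t - y1 t * x2 t) / (v t * v t)) = c) ->
  polar_system (fun t => v t / r t)
    (fun t => (x t * y1 t - y t * x1 t) / (r t * v t))
    (fun t => (x t * x1 t + y t * y1 t) / (r t * v t))
    r (fun t => x t / r t) (fun t => y t / r t) c.
Proof.
  intros Hx Hy Hx1 Hy1 Hr Er Hv Ev Hdr Hdv Px Py Px1 Py1 Pr Pv Hc.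
  assert (Hlag : forall t, (x t * x1 t + y t * y1 t) * (x t * x1 t + y t * y1 t)
      + (x t * y1 t - y t * x1 t) * (x t * y1 t - y t * x1 t) = r t * r t * (v t * v t)).
  { intros t. rewrite Er, Ev. ring. }
  constructor; intros t; pose proof (Hr t) as Hrt; pose proof (Hv t) as Hvt;
    assert (Nr : r t <> 0) by lra; assert (Nv : v t <> 0) by lra.
  - apply Rdiv_lt_0_compat; auto.
  - apply (ex_derive_continuous (K := R_AbsRing) (V := R_NormedModule)).
    auto_derive. repeat split; auto; eexists; eauto.
  - now rewrite Pr, Pv.
  - exact Hrt.
  - apply Pr.
  - now rewrite Px, Py, Px1, Py1, Pr, Pv.
  - transitivity (((x t * x1 t + y t * y1 t) * (x t * x1 t + y t * y1 t)
      + (x t * y1 t - y t * x1 t) * (x t * y1 t - y t * x1 t)) / (r t * r t * (v t * v t))).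
    + field. auto.
    + rewrite Hlag. field. auto.
  - transitivity ((x t * x t + y t * y t) / (r t * r t)); [field; auto|]. rewrite <- Er. field. auto.
  - evar_last; [apply Hdr|]. field. auto.
  - evar_last.
    + auto_derive; [repeat split; try (eexists; now eauto); nra|reflexivity].
    + rewrite (is_derive_unique (fun s : R => x s) _ _ (Hx t)), (is_derive_unique (fun s : R => y s) _ _ (Hy t)),
        (is_derive_unique (fun s : R => x1 s) _ _ (Hx1 t)), (is_derive_unique (fun s : R => y1 s) _ _ (Hy1 t)),
        (is_derive_unique (fun s : R => r s) _ _ (Hdr t)), (is_derive_unique (fun s : R => v s) _ _ (Hdv t)).
      rewrite <- (Hc t). specialize (Hlag t).
      (* Real part of the product of [conj(gamma) gamma' = D + i W] and
         [conj(gamma') gamma'' = N + i W2], which equals [v^2 conj(gamma) gamma'']. *)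
      assert (K : x t * x2 t + y t * y2 t
        = ((x t * x1 t + y t * y1 t) * (x1 t * x2 t + y1 t * y2 t)
          - (x t * y1 t - y t * x1 t) * (x1 t * y2 t - y1 t * x2 t)) / (v t * v t)).
      { rewrite Ev. field. rewrite <- Ev. nra. }
      assert (K' : 1 * x1 t * x1 t + x t * (1 * x2 t) + (1 * y1 t * y1 t + y t * (1 * y2 t))
        = v t * v t + (x t * x2 t + y t * y2 t)) by (rewrite Ev; ring).
      rewrite K', K. clear K K' Hc.
      set (D := x t * x1 t + y t * y1 t) in *. set (W := x t * y1 t - y t * x1 t) in *.
      set (N := x1 t * x2 t + y1 t * y2 t). set (W2 := x1 t * y2 t - y1 t * x2 t).
      transitivity ((r t * r t * (v t * v t) - D * D - r t * r t * W * W2 / (v t * v t)) / (r t * r t * r t * v t)).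
      * field. auto.
      (* With [r^2 v^2 = D^2 + W^2] the terms free of [W2] reduce to [W^2]. *)
      * rewrite <- Hlag. field. auto.
  - evar_last.
    + auto_derive; [repeat split; try (eexists; now eauto); nra|reflexivity].
    + rewrite (is_derive_unique (fun s : R => x s) _ _ (Hx t)), (is_derive_unique (fun s : R => y s) _ _ (Hy t)),
        (is_derive_unique (fun s : R => x1 s) _ _ (Hx1 t)), (is_derive_unique (fun s : R => y1 s) _ _ (Hy1 t)),
        (is_derive_unique (fun s : R => r s) _ _ (Hdr t)), (is_derive_unique (fun s : R => v s) _ _ (Hdv t)).
      rewrite <- (Hc t).
      (* Imaginary part of the same product. *)
      assert (K : x t * y2 t - y t * x2 t
        = ((x t * x1 t + y t * y1 t) * (x1 t * y2 t - y1 t * x2 t)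
          + (x t * y1 t - y t * x1 t) * (x1 t * x2 t + y1 t * y2 t)) / (v t * v t)).
      { rewrite Ev. field. rewrite <- Ev. nra. }
      replace (1 * x1 t * y1 t + x t * (1 * y2 t) + - (1 * y1 t * x1 t + y t * (1 * x2 t)))
        with (x t * y2 t - y t * x2 t) by ring.
      rewrite K. clear K Hc.
      set (D := x t * x1 t + y t * y1 t) in *. set (W := x t * y1 t - y t * x1 t) in *.
      set (N := x1 t * x2 t + y1 t * y2 t). set (W2 := x1 t * y2 t - y1 t * x2 t).
      replace (x t * y1 t + - (y t * x1 t)) with W by (unfold W; ring).
      field. auto.
  - evar_last.
    + auto_derive; [repeat split; try (eexists; now eauto); nra|reflexivity].
    + rewrite (is_derive_unique (fun s : R => x s) _ _ (Hx t)), (is_derive_unique (fun s : R => r s) _ _ (Hdr t)).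
      transitivity ((x1 t * (r t * r t) - x t * (x t * x1 t + y t * y1 t)) / (r t * r t * r t)); [field; auto|].
      rewrite (Er t) at 1. field. auto.
  - evar_last.
    + auto_derive; [repeat split; try (eexists; now eauto); nra|reflexivity].
    + rewrite (is_derive_unique (fun s : R => y s) _ _ (Hy t)), (is_derive_unique (fun s : R => r s) _ _ (Hdr t)).
      transitivity ((y1 t * (r t * r t) - y t * (x t * x1 t + y t * y1 t)) / (r t * r t * r t)); [field; auto|].
      rewrite (Er t) at 1. field. auto.
Qed.

(** * Geometry of the twisted torus *)

(* The map [(a, b) |-> (z1(b) e^(ia), z2(b) e^(-ia)) / sqrt 2] with
   [z1 = p1 + i q1] and [z2 = p2 + i q2]; this class of maps contains the twisted
   torus and is closed under [J] and both partial derivatives. *)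
Definition lift (p1 q1 p2 q2 : R -> R) : R -> R -> V4 := fun a b k =>
  match k with
  | 0%nat => (p1 b * cos a - q1 b * sin a) / sqrt 2
  | 1%nat => (p1 b * sin a + q1 b * cos a) / sqrt 2
  | 2%nat => (p2 b * cos a + q2 b * sin a) / sqrt 2
  | 3%nat => (q2 b * cos a - p2 b * sin a) / sqrt 2
  | _ => 0 end.

Lemma sqrt2_neq_0 : sqrt 2 <> 0.
Proof. pose proof Rlt_sqrt2_0. lra. Qed.

Lemma twisted_torus_lift (gamma : R -> C) :
  twisted_torus gamma
  = lift (fun t => fst (gamma t)) (fun t => snd (gamma t))
      (fun t => fst (gamma t)) (fun t => snd (gamma t)).
Proof.
  extensionality a. extensionality b. extensionality k. pose proof sqrt2_neq_0.
  destruct k as [|[|[|[|k]]]]; simpl; try field; auto.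
Qed.

(** Differentiation in [a] multiplies [z1] by [i] and [z2] by [- i]. *)
Lemma pd0_lift (p1 q1 p2 q2 : R -> R) :
  pd 0 (lift p1 q1 p2 q2) = lift (fun t => - q1 t) p1 q2 (fun t => - p2 t).
Proof.
  extensionality a. extensionality b. extensionality k. pose proof sqrt2_neq_0.
  unfold pd, pds, lift. apply is_derive_unique.
  destruct k as [|[|[|[|k]]]]; simpl; auto_derive; auto; field; auto.
Qed.

Lemma pd1_lift (p1 q1 p2 q2 p1' q1' p2' q2' : R -> R) :
  (forall t, is_derive p1 t (p1' t)) -> (forall t, is_derive q1 t (q1' t)) ->
  (forall t, is_derive p2 t (p2' t)) -> (forall t, is_derive q2 t (q2' t)) ->
  pd 1 (lift p1 q1 p2 q2) = lift p1' q1' p2' q2'.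
Proof.
  intros H1 H2 H3 H4.
  extensionality a. extensionality b. extensionality k. pose proof sqrt2_neq_0.
  unfold pd, pds, lift. apply is_derive_unique.
  destruct k as [|[|[|[|k]]]]; simpl;
    (evar_last; [auto_derive; [repeat split; (eexists; now eauto)|reflexivity]|]);
    rewrite ?(is_derive_unique (fun s : R => p1 s) _ _ (H1 b)),
      ?(is_derive_unique (fun s : R => q1 s) _ _ (H2 b)),
      ?(is_derive_unique (fun s : R => p2 s) _ _ (H3 b)),
      ?(is_derive_unique (fun s : R => q2 s) _ _ (H4 b)); try field; auto.
Qed.

Lemma Jmul_lift (p1 q1 p2 q2 : R -> R) (a b : R) :
  Jmul (lift p1 q1 p2 q2 a b) = lift (fun t => - q1 t) p1 (fun t => - q2 t) p2 a b.
Proof.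
  extensionality k. pose proof sqrt2_neq_0.
  destruct k as [|[|[|[|k]]]]; simpl; try field; auto.
Qed.

(** The phases [exp (i a)] and [exp (- i a)] act by rotations, so [a] drops out. *)
Lemma dot_lift (p1 q1 p2 q2 p1' q1' p2' q2' : R -> R) (a b : R) :
  dot (lift p1 q1 p2 q2 a b) (lift p1' q1' p2' q2' a b)
  = (p1 b * p1' b + q1 b * q1' b + p2 b * p2' b + q2 b * q2' b) / 2.
Proof.
  unfold dot, lift. pose proof sqrt2_neq_0.
  assert (E : sqrt 2 * sqrt 2 = 2) by (apply sqrt_sqrt; lra).
  pose proof (sin2_cos2 a) as T. unfold Rsqr in T.
  transitivity ((p1 b * p1' b + q1 b * q1' b + p2 b * p2' b + q2 b * q2' b)
    * (sin a * sin a + cos a * cos a) / (sqrt 2 * sqrt 2)).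
  - field. auto.
  - rewrite E, T. field.
Qed.

(** The hypothesis is the Lagrangian condition: [J] carries tangent vectors to normal ones, so the
    tangential part removed by the projection contributes nothing. *)
Lemma dot_Jmul_normproj (F : R -> R -> V4) (a b : R) (v : V4) (j : nat) :
  (forall k, (k < 2)%nat -> dot (Jmul (pd k F a b)) (pd j F a b) = 0) ->
  dot (Jmul (normproj F a b v)) (pd j F a b) = dot (Jmul v) (pd j F a b).
Proof.
  intros H. pose proof (H 0%nat ltac:(auto)) as H0. pose proof (H 1%nat ltac:(auto)) as H1.
  transitivity (dot (Jmul v) (pd j F a b)
    - (ginv F 0 0 a b * dot v (pd 0 F a b) + ginv F 0 1 a b * dot v (pd 1 F a b))
      * dot (Jmul (pd 0 F a b)) (pd j F a b)
    - (ginv F 1 0 a b * dot v (pd 0 F a b) + ginv F 1 1 a b * dot v (pd 1 F a b))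
      * dot (Jmul (pd 1 F a b)) (pd j F a b)).
  - unfold normproj, tanproj, vsum2, vsub, vadd, vscal.
    generalize (ginv F 0 0 a b) (ginv F 0 1 a b) (ginv F 1 0 a b) (ginv F 1 1 a b)
      (dot v (pd 0 F a b)) (dot v (pd 1 F a b)) (pd 0 F a b) (pd 1 F a b) (pd j F a b).
    intros. unfold dot, Jmul. ring.
  - rewrite H0, H1. ring.
Qed.

Lemma dot_Jmul_meancurv (F : R -> R -> V4) (a b : R) (j : nat) :
  (forall k, (k < 2)%nat -> dot (Jmul (pd k F a b)) (pd j F a b) = 0) ->
  dot (Jmul (meancurv F a b)) (pd j F a b)
  = ginv F 0 0 a b * dot (Jmul (pd 0 (pd 0 F) a b)) (pd j F a b)
    + ginv F 0 1 a b * dot (Jmul (pd 0 (pd 1 F) a b)) (pd j F a b)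
    + ginv F 1 0 a b * dot (Jmul (pd 1 (pd 0 F) a b)) (pd j F a b)
    + ginv F 1 1 a b * dot (Jmul (pd 1 (pd 1 F) a b)) (pd j F a b).
Proof.
  intros H.
  transitivity (ginv F 0 0 a b * dot (Jmul (sff F 0 0 a b)) (pd j F a b)
    + ginv F 0 1 a b * dot (Jmul (sff F 0 1 a b)) (pd j F a b)
    + ginv F 1 0 a b * dot (Jmul (sff F 1 0 a b)) (pd j F a b)
    + ginv F 1 1 a b * dot (Jmul (sff F 1 1 a b)) (pd j F a b)).
  - unfold meancurv, vsum2, vadd, vscal.
    generalize (ginv F 0 0 a b) (ginv F 0 1 a b) (ginv F 1 0 a b) (ginv F 1 1 a b)
      (sff F 0 0 a b) (sff F 0 1 a b) (sff F 1 0 a b) (sff F 1 1 a b).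
    intros. unfold dot, Jmul. ring.
  - unfold sff. now rewrite !dot_Jmul_normproj by exact H.
Qed.

(* Up to the factor [- / sqrt (det g)], the derivative of this function is
   [div_g (J H)]. *)
Definition maslov_density (x y x1 y1 x2 y2 : R -> R) (t : R) : R :=
  sqrt (x t * x t + y t * y t) / sqrt (x1 t * x1 t + y1 t * y1 t)
  * ((x t * y1 t - y t * x1 t) / (x t * x t + y t * y t)
     + (x1 t * y2 t - y1 t * x2 t) / (x1 t * x1 t + y1 t * y1 t)).

(** The metric is diagonal with entries [r^2] and [v^2]. The [a]-component of [J H] vanishes because
    the two complex coordinates contribute with opposite signs; the [b]-component times
    [sqrt (det g) = r v] is [- (r / v) (phi' + psi')]. *)
Lemma div_g_twisted_torus (gamma : R -> C) (x1 y1 x2 y2 : R -> R) (a b : R) :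
  let x t := fst (gamma t) in let y t := snd (gamma t) in
  (forall t, is_derive x t (x1 t)) -> (forall t, is_derive y t (y1 t)) ->
  (forall t, is_derive x1 t (x2 t)) -> (forall t, is_derive y1 t (y2 t)) ->
  (forall t, 0 < x t * x t + y t * y t) -> (forall t, 0 < x1 t * x1 t + y1 t * y1 t) ->
  div_g (twisted_torus gamma) (fun a' b' => Jmul (meancurv (twisted_torus gamma) a' b')) a b
  = - / sqrt ((x b * x b + y b * y b) * (x1 b * x1 b + y1 b * y1 b))
    * Derive (maslov_density x y x1 y1 x2 y2) b.
Proof.
  intros x y Hx Hy Hx1 Hy1 Hr Hv.
  rewrite twisted_torus_lift. change (fun t => fst (gamma t)) with x.
  change (fun t => snd (gamma t)) with y.
  clearbody x y. set (F := lift x y x y).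
  assert (E0 : pd 0 F = lift (fun t => - y t) x y (fun t => - x t)) by apply pd0_lift.
  assert (E1 : pd 1 F = lift x1 y1 x1 y1) by (now apply pd1_lift).
  assert (E00 : pd 0 (pd 0 F) = lift (fun t => - x t) (fun t => - y t) (fun t => - x t) (fun t => - y t)).
  { rewrite E0. apply pd0_lift. }
  assert (E11 : pd 1 (pd 1 F) = lift x2 y2 x2 y2) by (rewrite E1; now apply pd1_lift).
  assert (G00 : forall a b, metric F 0 0 a b = x b * x b + y b * y b).
  { intros. unfold metric. rewrite E0, dot_lift. field. }
  assert (G01 : forall a b, metric F 0 1 a b = 0).
  { intros. unfold metric. rewrite E0, E1, dot_lift. field. }
  assert (G10 : forall a b, metric F 1 0 a b = 0).
  { intros. unfold metric. rewrite E0, E1, dot_lift. field. }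
  assert (G11 : forall a b, metric F 1 1 a b = x1 b * x1 b + y1 b * y1 b).
  { intros. unfold metric. rewrite E1, dot_lift. field. }
  assert (Dt : forall a b, detg F a b = (x b * x b + y b * y b) * (x1 b * x1 b + y1 b * y1 b)).
  { intros. unfold detg. rewrite G00, G01, G11, G10. ring. }
  assert (I00 : forall a b, ginv F 0 0 a b = / (x b * x b + y b * y b)).
  { intros. unfold ginv. rewrite Dt, G11. field. split; apply not_eq_sym, Rlt_not_eq; auto. }
  assert (I11 : forall a b, ginv F 1 1 a b = / (x1 b * x1 b + y1 b * y1 b)).
  { intros. unfold ginv. rewrite Dt, G00. field. split; apply not_eq_sym, Rlt_not_eq; auto. }
  assert (I01 : forall a b, ginv F 0 1 a b = 0).
  { intros. unfold ginv. rewrite G01. unfold Rdiv. ring. }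
  assert (I10 : forall a b, ginv F 1 0 a b = 0).
  { intros. unfold ginv. rewrite G01. unfold Rdiv. ring. }
  assert (L : forall a b j k, (j < 2)%nat -> (k < 2)%nat -> dot (Jmul (pd k F a b)) (pd j F a b) = 0).
  { intros a' b' [|[|j]] [|[|k]] Hj Hk; try lia; rewrite ?E0, ?E1, Jmul_lift, dot_lift; field. }
  assert (M0 : forall a b, dot (Jmul (meancurv F a b)) (pd 0 F a b) = 0).
  { intros a' b'. rewrite dot_Jmul_meancurv by (intros; apply L; auto).
    rewrite I01, I10, E00, E11, E0, !Jmul_lift, !dot_lift. field. }
  assert (M1 : forall a b, dot (Jmul (meancurv F a b)) (pd 1 F a b)
    = - ((x b * y1 b - y b * x1 b) / (x b * x b + y b * y b)
         + (x1 b * y2 b - y1 b * x2 b) / (x1 b * x1 b + y1 b * y1 b))).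
  { intros a' b'. rewrite dot_Jmul_meancurv by (intros; apply L; auto).
    rewrite I01, I10, I00, I11, E00, E11, E1, !Jmul_lift, !dot_lift. field.
    split; apply not_eq_sym, Rlt_not_eq; auto. }
  assert (T0 : forall a b, tcomp F (fun a b => Jmul (meancurv F a b)) 0 a b = 0).
  { intros. unfold tcomp, sum2. rewrite M0, I01. ring. }
  unfold div_g, sum2, pds.
  rewrite (Derive_ext (fun s => sqrt (detg F s b) * _) (fun _ => 0)) by (intros; rewrite T0; ring).
  rewrite Derive_const, Dt, Rplus_0_l, Ropp_mult_distr_l_reverse, <- Ropp_mult_distr_r_reverse, <- Derive_opp.
  f_equal. apply Derive_ext. intros t. unfold maslov_density.
  unfold tcomp, sum2. rewrite M0, M1, I11, Dt, sqrt_mult by (apply Rlt_le; auto).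
  pose proof (Hr t). pose proof (Hv t).
  (* One [v^2] is split as [v * v] so that [r v / v^2] simplifies to [r / v]. *)
  rewrite <- (sqrt_sqrt (x1 t * x1 t + y1 t * y1 t)) at 2 by lra.
  pose proof (sqrt_lt_R0 _ (Hv t)).
  field. lra.
Qed.

Lemma maslov_density_ex_derive (x y x1 y1 x2 y2 : R -> R) (t : R) :
  ex_derive x t -> ex_derive y t -> ex_derive x1 t -> ex_derive y1 t ->
  ex_derive x2 t -> ex_derive y2 t ->
  0 < x t * x t + y t * y t -> 0 < x1 t * x1 t + y1 t * y1 t ->
  ex_derive (maslov_density x y x1 y1 x2 y2) t.
Proof.
  intros. unfold maslov_density.
  pose proof (sqrt_lt_R0 (x1 t * x1 t + y1 t * y1 t)).
  auto_derive. repeat split; auto; lra.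
Qed.

(** On a circle about the origin tangent and polar angle turn at the same rate, so the density is 2
    or -2 according to orientation; squaring treats both orientations at once. *)
Lemma maslov_density_circle (x y x1 y1 x2 y2 : R -> R) (m : R) :
  (forall t, is_derive x t (x1 t)) -> (forall t, is_derive y t (y1 t)) ->
  (forall t, is_derive x1 t (x2 t)) -> (forall t, is_derive y1 t (y2 t)) ->
  (forall t, 0 < x1 t * x1 t + y1 t * y1 t) ->
  0 < m -> (forall t, x t * x t + y t * y t = m) ->
  forall t, maslov_density x y x1 y1 x2 y2 t * maslov_density x y x1 y1 x2 y2 t = 4.
Proof.
  intros Hx Hy Hx1 Hy1 Hv Hm Hxy t.
  pose proof (constant_modulus_orthogonal x y x1 y1 m Hx Hy Hxy) as HD.
  (* Half the second derivative of the constant [|gamma|^2]. *)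
  assert (HD' : x1 t * x1 t + y1 t * y1 t + (x t * x2 t + y t * y2 t) = 0).
  { assert (E : is_derive (fun t => x t * x1 t + y t * y1 t) t
      (x1 t * x1 t + y1 t * y1 t + (x t * x2 t + y t * y2 t))).
    { evar_last.
      - auto_derive; [repeat split; (eexists; now eauto)|reflexivity].
      - rewrite (is_derive_unique (fun s : R => x s) _ _ (Hx t)),
          (is_derive_unique (fun s : R => y s) _ _ (Hy t)),
          (is_derive_unique (fun s : R => x1 s) _ _ (Hx1 t)),
          (is_derive_unique (fun s : R => y1 s) _ _ (Hy1 t)). ring. }
    assert (E0 : is_derive (fun t => x t * x1 t + y t * y1 t) t 0).
    { apply (is_derive_ext (fun _ => 0)); [intros; now rewrite HD|].
      apply (is_derive_const (K := R_AbsRing) (V := R_NormedModule)). }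
    apply is_derive_unique in E. apply is_derive_unique in E0. lra. }
  specialize (HD t). specialize (Hv t). specialize (Hxy t). unfold maslov_density.
  set (W := x t * y1 t - y t * x1 t). set (W2 := x1 t * y2 t - y1 t * x2 t).
  set (n := x1 t * x1 t + y1 t * y1 t) in *.
  assert (EW : W * W = m * n).
  { rewrite <- Hxy. transitivity ((x t * x t + y t * y t) * n
      - (x t * x1 t + y t * y1 t) * (x t * x1 t + y t * y1 t)); [unfold W, n; ring|].
    rewrite HD. ring. }
  assert (EW2 : W * W2 = n * n).
  { transitivity ((x t * x1 t + y t * y1 t) * (x1 t * x2 t + y1 t * y2 t)
      - n * (x t * x2 t + y t * y2 t)); [unfold W, W2, n; ring|].
    rewrite HD. replace (x t * x2 t + y t * y2 t) with (- n) by lra. ring. }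
  assert (NW : W <> 0).
  { intros E. rewrite E in EW. pose proof (Rmult_lt_0_compat _ _ Hm Hv). lra. }
  (* This is [psi' = phi'], as [psi' = W2 / n] and [phi' = W / m]. *)
  assert (EW2' : W2 = n * W / m).
  { apply (Rmult_eq_reg_l W); [|exact NW]. rewrite EW2.
    replace (W * (n * W / m)) with (n * (W * W) / m) by (field; lra).
    rewrite EW. field. lra. }
  rewrite Hxy, EW2'.
  pose proof (sqrt_lt_R0 _ Hv). pose proof (sqrt_lt_R0 _ Hm).
  transitivity (4 * (sqrt m * sqrt m) * (W * W) / (sqrt n * sqrt n * (m * m))).
  - field. lra.
  - rewrite !sqrt_sqrt, EW by lra. field. lra.
Qed.

(** * Circles about the origin as curves of constant modulus, and the equivalence *)

(** A circle is defined by its full image, so the converse needs that a regular closed curve of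
    constant modulus misses no point of the circle. *)
Lemma circle_iff_constant_modulus (gamma : R -> C) :
  smooth_regular_simple_closed_curve_avoiding_0 gamma ->
  is_circle_centred_at_origin gamma <->
  exists r, 0 < r /\ forall t, Cmod (gamma t) = r.
Proof.
  intros (Sx & Sy & Hper & Hreg & _ & _). split.
  - intros (r & Hr & H). exists r. split; [exact Hr|]. intros t. apply H. now exists t.
  - intros (r & Hr & H). exists r. split; [exact Hr|].
    intros z. split; [intros [t <-]; apply H|]. intros Hz.
    assert (Emod : forall u : C, Cmod u = r -> fst u * fst u + snd u * snd u = r * r).
    { intros u <-. unfold Cmod. rewrite sqrt_sqrt; [ring|].
      pose proof (pow2_ge_0 (fst u)). pose proof (pow2_ge_0 (snd u)). lra. }
    pose (x t := fst (gamma t)). pose (y t := snd (gamma t)).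
    assert (Hx : forall t, is_derive x t (Derive x t)) by (intros t; apply Derive_correct, (Sx 1%nat)).
    assert (Hy : forall t, is_derive y t (Derive y t)) by (intros t; apply Derive_correct, (Sy 1%nat)).
    assert (Px : forall t, x (t + 2 * PI) = x t) by (intros t; unfold x; now rewrite Hper).
    assert (Py : forall t, y (t + 2 * PI) = y t) by (intros t; unfold y; now rewrite Hper).
    destruct (constant_modulus_curve_covers_circle x y (Derive x) (Derive y) (2 * PI) r)
      with (u := fst z) (v := snd z) as [t [E1 E2]]; auto.
    + intros t. apply (ex_derive_continuous (K := R_AbsRing) (V := R_NormedModule)), (Sx 2%nat).
    + intros t. apply (ex_derive_continuous (K := R_AbsRing) (V := R_NormedModule)), (Sy 2%nat).
    + pose proof PI_RGT_0. lra.
    + now apply is_derive_periodic with (1 := Hx).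
    + now apply is_derive_periodic with (1 := Hy).
    + intros t. apply sumsq_pos, Hreg.
    + intros t. apply Emod, H.
    + exists t. destruct z. unfold x, y in *. simpl in *.
      rewrite (surjective_pairing (gamma t)). congruence.
Qed.

Theorem theorem1 (gamma : R -> C) :
  smooth_regular_simple_closed_curve_avoiding_0 gamma ->
  (hamiltonian_stationary (twisted_torus gamma) <-> is_circle_centred_at_origin gamma).
Proof.
  intros Hg. rewrite (circle_iff_constant_modulus gamma Hg).
  destruct Hg as (Sx & Sy & Hper & Hreg & Hinj & Hne).
  pose (x t := fst (gamma t)). pose (y t := snd (gamma t)).
  set (x1 := Derive x). set (y1 := Derive y). set (x2 := Derive x1). set (y2 := Derive y1).
  assert (Hx : forall t, is_derive x t (x1 t)) by (intros t; apply Derive_correct, (Sx 1%nat)).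
  assert (Hy : forall t, is_derive y t (y1 t)) by (intros t; apply Derive_correct, (Sy 1%nat)).
  assert (Hx1 : forall t, is_derive x1 t (x2 t)) by (intros t; apply Derive_correct, (Sx 2%nat)).
  assert (Hy1 : forall t, is_derive y1 t (y2 t)) by (intros t; apply Derive_correct, (Sy 2%nat)).
  assert (Hx2 : forall t, ex_derive x2 t) by (intros t; exact (Sx 3%nat t)).
  assert (Hy2 : forall t, ex_derive y2 t) by (intros t; exact (Sy 3%nat t)).
  assert (Hr : forall t, 0 < x t * x t + y t * y t).
  { intros t. apply sumsq_pos. unfold x, y. rewrite <- surjective_pairing. apply Hne. }
  assert (Hv : forall t, 0 < x1 t * x1 t + y1 t * y1 t) by (intros t; apply sumsq_pos, Hreg).
  assert (Px : forall t, x (t + 2 * PI) = x t) by (intros t; unfold x; now rewrite Hper).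
  assert (Py : forall t, y (t + 2 * PI) = y t) by (intros t; unfold y; now rewrite Hper).
  pose proof (is_derive_periodic _ _ _ Hx Px) as Px1.
  pose proof (is_derive_periodic _ _ _ Hy Py) as Py1.
  assert (Hmod : forall t, Cmod (gamma t) = sqrt (x t * x t + y t * y t)).
  { intros t. unfold Cmod, x, y. f_equal. ring. }
  pose (Q := maslov_density x y x1 y1 x2 y2).
  assert (HQ : forall t, ex_derive Q t).
  { intros t. apply maslov_density_ex_derive; auto; eexists; eauto. }
  (* The factor [- / sqrt (det g)] never vanishes. *)
  assert (Hstat : hamiltonian_stationary (twisted_torus gamma) <-> forall t, Derive Q t = 0).
  { assert (E : forall a b, div_g (twisted_torus gamma)
        (fun a' b' => Jmul (meancurv (twisted_torus gamma) a' b')) a b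
      = - / sqrt ((x b * x b + y b * y b) * (x1 b * x1 b + y1 b * y1 b)) * Derive Q b).
    { intros a b. exact (div_g_twisted_torus gamma x1 y1 x2 y2 a b Hx Hy Hx1 Hy1 Hr Hv). }
    split.
    - intros H t. specialize (H 0 t). rewrite E in H.
      apply Rmult_integral in H. destruct H as [H|H]; [exfalso|exact H].
      pose proof (Rinv_0_lt_compat _ (sqrt_lt_R0 _ (Rmult_lt_0_compat _ _ (Hr t) (Hv t)))). lra.
    - intros H a b. rewrite E, H. ring. }
  rewrite Hstat. split.
  - intros HQ0.
    pose (r t := sqrt (x t * x t + y t * y t)). pose (v t := sqrt (x1 t * x1 t + y1 t * y1 t)).
    assert (Er : forall t, r t * r t = x t * x t + y t * y t).
    { intros t. apply sqrt_sqrt, Rlt_le, Hr. }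
    assert (Ev : forall t, v t * v t = x1 t * x1 t + y1 t * y1 t).
    { intros t. apply sqrt_sqrt, Rlt_le, Hv. }
    assert (Pr : forall t, r (t + 2 * PI) = r t) by (intros t; unfold r; now rewrite Px, Py).
    assert (Pv : forall t, v (t + 2 * PI) = v t) by (intros t; unfold v; now rewrite Px1, Py1).
    assert (HQc : forall t, Q t = Q 0).
    { intros t. apply is_derive_zero_const. intros s. rewrite <- (HQ0 s). apply Derive_correct, HQ. }
    assert (P : polar_system (fun t => v t / r t)
        (fun t => (x t * y1 t - y t * x1 t) / (r t * v t))
        (fun t => (x t * x1 t + y t * y1 t) / (r t * v t))
        r (fun t => x t / r t) (fun t => y t / r t) (Q 0)).
    { apply polar_system_of_curve with (x2 := x2) (y2 := y2); auto.
      - intros t. apply sqrt_lt_R0, Hr.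
      - intros t. apply sqrt_lt_R0, Hv.
      - intros t. now apply is_derive_modulus.
      - intros t. now apply is_derive_modulus.
      - intros t. rewrite Er, Ev. apply HQc. }
    pose proof (ps_r _ _ _ _ _ _ _ P) as Hr0.
    exists (r 0). split; [apply Hr0|]. intros t. rewrite Hmod.
    apply (polar_system_simple_radius_const _ _ _ _ _ _ _ P). clear t.
    intros t1 t2 E1 E2 E3. simpl in *.
    assert (F : gamma t1 = gamma t2).
    { rewrite (surjective_pairing (gamma t1)), (surjective_pairing (gamma t2)).
      rewrite E1 in E2, E3. specialize (Hr0 t2).
      f_equal; apply (Rmult_eq_reg_r (/ r t2)); auto; apply Rinv_neq_0_compat; lra. }
    assert (H2pi : 0 < 2 * PI) by (pose proof PI_RGT_0; lra).
    (* Injectivity is available only on [[0, 2 PI)], so both parameters are reduced modulo the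
       period; they then differ by full periods, under which the tangent cosine is invariant. *)
    destruct (fundamental_domain _ t1 H2pi) as [n1 [s1 [Hs1 ->]]].
    destruct (fundamental_domain _ t2 H2pi) as [n2 [s2 [Hs2 ->]]].
    assert (Es : s1 = s2).
    { apply Hinj; auto. rewrite (surjective_pairing (gamma s1)), (surjective_pairing (gamma s2)).
      pose proof (f_equal fst F) as F1. pose proof (f_equal snd F) as F2.
      change (x (s1 + IZR n1 * (2 * PI)) = x (s2 + IZR n2 * (2 * PI))) in F1.
      change (y (s1 + IZR n1 * (2 * PI)) = y (s2 + IZR n2 * (2 * PI))) in F2.
      rewrite !periodic_IZR in F1, F2 by assumption. f_equal; assumption. }
    subst s2.
    now rewrite !(periodic_IZR x _ Px), !(periodic_IZR y _ Py), !(periodic_IZR x1 _ Px1),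
      !(periodic_IZR y1 _ Py1), !(periodic_IZR r _ Pr), !(periodic_IZR v _ Pv).
  - intros (R0 & HR0 & H).
    assert (HRR : forall t, x t * x t + y t * y t = R0 * R0).
    { intros t. rewrite <- (H t), Hmod. symmetry. apply sqrt_sqrt, Rlt_le, Hr. }
    pose proof (maslov_density_circle x y x1 y1 x2 y2 _ Hx Hy Hx1 Hy1 Hv
      (Rmult_lt_0_compat _ _ HR0 HR0) HRR) as HQ4.
    fold Q in HQ4. intros t.
    (* Differentiating [Q^2 = 4] gives [2 Q Q' = 0] with [Q] nonzero, so no choice of orientation is
       needed. *)
    assert (E : is_derive (fun s => Q s * Q s) t (2 * Q t * Derive Q t)).
    { evar_last.
      - auto_derive; [repeat split; apply HQ|reflexivity].
      - change (Derive (fun s => Q s) t) with (Derive Q t). ring. }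
    assert (E0 : is_derive (fun s => Q s * Q s) t 0).
    { apply (is_derive_ext (fun _ => 4)); [intros; now rewrite HQ4|].
      apply (is_derive_const (K := R_AbsRing) (V := R_NormedModule)). }
    apply is_derive_unique in E. apply is_derive_unique in E0. rewrite E in E0.
    specialize (HQ4 t). nra.
Qed.
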